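(* Let $s,C>0$ be constants and let $c:\mathbb{R}\to\mathbb{R}$ be a cost function satisfying the cost assumptions listed in the context. Then $$\mathrm{KL}^\star=\mathrm{KL}^\star_{\mathrm{add}},$$ and there exists $P^\star\in\mathscr{P}_{\mathrm{add}}$ achieving this value, i.e. $\sup_{a\in\mathbb{R}:|a|\le s}D(P^\star\|T_aP^\star)=\mathrm{KL}^\star$. Further, any such $P^\star$ is necessarily absolutely continuous with respect to the Lebesgue measure on $\mathbb{R}$.
   Context: Cost assumptions on $c:\mathbb{R}\to\mathbb{R}$: (positivity) $c(x)\ge 0$ for all $x$ and $c(0)=0$; (symmetry) $c(x)=c(-x)$ for all $x$; (monotonicity) $c(x)\le c(x')$ whenever $|x|\le|x'|$; (continuity) $c$ is continuous on $\mathbb{R}$; (tail regularity) there exist $\alpha,\beta>0$ such that $c(x)\sim\beta x^\alpha$ as $x\to\infty$. $D(P\|Q)$ denotes the Kullback-Leibler divergence (equal to $+\infty$ if $P\not\ll Q$). $\mathscr{R}$ is the set of all Markov kernels on $\mathbb{R}$, i.e. conditional distributions $P_{Y|X}$, where for each $x\in\mathbb{R}$, $P_{Y|X=x}$ is a Borel probability measure on $\mathbb{R}$, and $x\mapsto P_{Y|X=x}(B)$ is a Borel function for every Borel set $B\subset\mathbb{R}$. $\mathscr{B}$ is the set of all Borel probability measures on $\mathbb{R}$. For $P\in\mathscr{B}$, $\mathbb{E}_P[f]=\int f\,dP$, and for $a\in\mathbb{R}$ the shifted measure is $(T_aP)(B)=P(B-a)$. Define $$\mathscr{P}=\Big\{P_{Y|X}\in\mathscr{R}:\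 \sup_{x\in\mathbb{R}}\int_{\mathbb{R}}c(y-x)\,P_{Y|X=x}(dy)\le C\Big\},\qquad \mathrm{KL}^\star=\inf_{P_{Y|X}\in\mathscr{P}}\ \sup_{x,x'\in\mathbb{R}:|x-x'|\le s}D(P_{Y|X=x}\|P_{Y|X=x'}),$$ $$\mathscr{P}_{\mathrm{add}}=\{P\in\mathscr{B}:\ \mathbb{E}_P[c]\le C\},\qquad \mathrm{KL}^\star_{\mathrm{add}}=\inf_{P\in\mathscr{P}_{\mathrm{add}}}\ \sup_{a\in\mathbb{R}:|a|\le s}D(P\|T_aP).$$ *)

(* Defs.v *)
From HB Require Import structures.
From mathcomp Require Import all_boot all_order all_algebra.
From mathcomp Require Import all_classical all_reals all_analysis.

Set Implicit Arguments.
Unset Strict Implicit.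
Unset Printing Implicit Defensive.

Import Order.TTheory GRing.Theory Num.Theory.
Import numFieldNormedType.Exports.

Local Open Scope classical_set_scope.
Local Open Scope ring_scope.

Record cost_assumptions (R : realType) (c : R -> R) : Prop := CostAssumptions {
  cost_ge0 : forall x, 0 <= c x;
  cost0 : c 0 = 0;
  cost_sym : forall x, c x = c (- x);
  cost_mono : forall x x', `|x| <= `|x'| -> c x <= c x';
  cost_continuous : continuous c;
  cost_tail : exists alpha beta : R, [/\ 0 < alpha, 0 < beta &
    c x / (beta * x `^ alpha) @[x --> +oo] --> (1 : R)] }.

Section kullback_leibler.
Context d (T : measurableType d) (R : realType).
Local Open Scope ereal_scope.
Local Open Scope charge_scope.

(* Natural logarithm, with lne 0 = -oo. The density vanishes only on a P-null
   set, and the negative part of the integrand is always P-integrable, so that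
   no indeterminate form occurs in the integral. *)
Definition KL (P Q : probability T R) : \bar R :=
  if `[< P `<< Q >]
  then \int[P]_x lne (('d (charge_of_finite_measure P) '/d Q) x)
  else +oo.

End kullback_leibler.

Section kernel_at.
Context d d' (X : measurableType d) (Y : measurableType d') (R : realType).

(* The measure k x, registered as a probability. *)
Definition kernel_at (k : R.-pker X ~> Y) (x : X) : set Y -> \bar R := k x.

HB.instance Definition _ (k : R.-pker X ~> Y) (x : X) :=
  Measure.copy (kernel_at k x) (k x).

HB.instance Definition _ (k : R.-pker X ~> Y) (x : X) :=
  Measure_isProbability.Build _ _ _ (kernel_at k x) (prob_kernel x).

End kernel_at.

Section translate.
Context (R : realType).
Notation TR := (measurableTypeR R).

Definition shift_fun (a : R) : TR -> TR := shift a.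

Lemma measurable_shift_fun (a : R) : measurable_fun setT (shift_fun a).
Proof.
by apply: measurable_realfun.measurable_funD => /=;
  [exact: measurable_id | exact: measurable_cst].
Qed.

HB.instance Definition _ (a : R) :=
  isMeasurableFun.Build _ _ TR TR (shift_fun a) (measurable_shift_fun a).

(* T_a P: the preimage of B under x |-> x + a is B - a. *)
Definition translate (a : R) (P : probability TR R) : probability TR R :=
  distribution P (shift_fun a).

End translate.

Section mechanisms.
Context (R : realType).
Notation TR := (measurableTypeR R).
Implicit Types (s C : R) (c : R -> R).
Local Open Scope ereal_scope.

Definition feasible_kernels C c : set (R.-pker TR ~> TR) :=
  [set k : R.-pker TR ~> TR | ereal_sup (range (fun x : R =>
             \int[kernel_at k x]_(y in [set: TR]) (c (y - x)%R)%:E)) <= C%:E].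

Definition kernel_sup_KL s (k : R.-pker TR ~> TR) : \bar R :=
  ereal_sup [set KL (kernel_at k p.1) (kernel_at k p.2) |
              p in [set p : R * R | (`|p.1 - p.2| <= s)%R]].

Definition KL_star s C c : \bar R :=
  ereal_inf (kernel_sup_KL s @` feasible_kernels C c).

Definition feasible_noises C c : set (probability TR R) :=
  [set P : probability TR R | 'E_P[c] <= C%:E].

Definition noise_sup_KL s (P : probability TR R) : \bar R :=
  ereal_sup [set KL P (translate a P) | a in [set a : R | (`|a| <= s)%R]].

Definition KL_star_add s C c : \bar R :=
  ereal_inf (noise_sup_KL s @` feasible_noises C c).

End mechanisms.

(* Main.v *)
(** The Donsker-Varadhan formula in the form D(P||Q) = sup_f E_P f + 1 - E_Q e^f,
    with f ranging over the measurable functions with finitely many values, is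
    linear in (P, Q) for each f. Given a kernel of cost at most C and divergence
    at most M, let X have a Laplace law of rate b and let P be the law of Y - X.
    Translating the law of X by a changes it by a factor at most e^(b|a|), so
    averaging the variational inequalities of the kernel gives
    E_P f + 1 - e^(b s) E_(T_a P) e^f <= M for |a| <= s, and P has cost at most C.
    Taking f = t 1_A and averaging over a in [-s, s] bounds P(A) in terms of the
    Lebesgue measure of A, uniformly in b; the cost bounds the tails. Hence the
    limits of P(A) along an ultrafilter, as b -> 0 and M -> KL*, are countably
    additive, and this setwise limit is an optimal noise, because each
    variational inequality involves only finitely many events. The same bound on
    P(A) gives absolute continuity as soon as KL* is finite, which is witnessed
    by a concentrated Laplace law. *)
From HB Require Import structures.
Require Import Defs.
From mathcomp Require Import all_boot all_order all_algebra.
From mathcomp Require Import all_classical all_reals all_analysis.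
From mathcomp Require Import measurable_realfun ring lra.

Set Implicit Arguments.
Unset Strict Implicit.
Unset Printing Implicit Defensive.

Import Order.TTheory GRing.Theory Num.Theory.
Import numFieldNormedType.Exports.

Local Open Scope classical_set_scope.
Local Open Scope ring_scope.

(** * Simple functions *)

Section probabilities.
Context d (T : measurableType d) (R : realType).
Implicit Types (P Q : probability T R).
Local Open Scope ereal_scope.

Lemma exists_probability (mu : set T -> \bar R) :
    mu set0 = 0 -> (forall A, 0 <= mu A) -> semi_sigma_additive mu ->
    mu setT = 1 ->
  exists P : probability T R, forall A, P A = mu A.
Proof.
move=> mu0 mu_ge0 mu_sigma muT.
pose M := isMeasure.Build _ _ _ mu mu0 mu_ge0 mu_sigma.
pose mu' : {measure set T -> \bar R} := HB.pack mu M.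
pose N := Measure_isProbability.Build _ _ _ mu' muT.
pose P : probability T R := HB.pack mu M N.
by exists P.
Qed.

(** Positive and negative parts are compared separately, and subtraction in [\bar R] is monotone
    even at infinite values; this covers [lne], which takes the value [-oo]. *)
Lemma le_integral_ae P (u v : T -> \bar R) :
    measurable_fun setT u -> measurable_fun setT v ->
    {ae P, forall x, u x <= v x} ->
  \int[P]_x u x <= \int[P]_x v x.
Proof.
move=> mu mv uv; rewrite integralE [leRHS]integralE; apply: leeB.
- apply: ae_ge0_le_integral => //; [exact: measurable_funepos..|].
  apply: filterS uv => x uvx _; rewrite !funeposE.
  by rewrite ge_max le_max uvx/= le_max lexx orbT.
- apply: ae_ge0_le_integral => //; [exact: measurable_funeneg..|].
  apply: filterS uv => x uvx _; rewrite !funenegE.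
  by rewrite ge_max le_max leeN2 uvx/= le_max lexx orbT.
Qed.

Lemma fine_probability_le1 P A : measurable A -> (fine (P A) <= 1)%R.
Proof. by move=> mA; rewrite -lee_fin fineK ?fin_num_measure// probability_le1. Qed.

Lemma integral_probability_cst P (k : \bar R) : \int[P]_x k = k.
Proof.
apply: etrans (integral_cst P measurableT k) _.
by rewrite [X in _ * X](probability_setT P) mule1.
Qed.

(* [r] lists the values of [f], and possibly other reals. *)
Definition simple_on (f : T -> R) (r : seq R) :=
  [/\ measurable_fun setT f, uniq r & forall x, f x \in r].

(** As a finite sum over level sets, the mean of [h \o f] depends on [P] through finitely many
    events, so that it passes to averages and setwise limits. *)
Definition simple_mean (P : set T -> \bar R) f (r : seq R) (h : R -> R) : R :=
  (\sum_(y <- r) h y * fine (P (f @^-1` [set y])))%R.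

Lemma measurable_level (f : T -> R) y :
  measurable_fun setT f -> measurable (f @^-1` [set y]).
Proof. by move=> mf; rewrite -[_ @^-1` _]setTI; exact: mf. Qed.

Lemma simple_sum f r (h : R -> R) x : simple_on f r ->
  h (f x) = (\sum_(y <- r) h y * \1_(f @^-1` [set y]) x)%R.
Proof.
case=> mf ur /(_ x) fr; rewrite (bigD1_seq (f x))//= big1 => [|y yfx].
  by rewrite addr0 indicE mem_set// mulr1.
by rewrite indicE memNset ?mulr0// => /= /esym/eqP; exact/negP.
Qed.

Lemma integrable_simple P f r h : simple_on f r ->
  P.-integrable setT (fun x => (h (f x))%:E).
Proof.
move=> fr; have [mf _ _] := fr.
apply: (eq_integrable measurableT
  (fun x => \sum_(y <- r) (h y)%:E * (\1_(f @^-1` [set y]) x)%:E)).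
  by move=> x _; rewrite (simple_sum h x fr) -sumEFin.
apply: integrable_sum => // y _; apply: integrableZl => //.
by apply: integrable_indic; exact: measurable_level.
Qed.

Lemma integral_simple P f r h : simple_on f r ->
  \int[P]_x (h (f x))%:E = (simple_mean P f r h)%:E.
Proof.
move=> fr; have [mf _ _] := fr.
rewrite (eq_integral
  (fun x => \sum_(y <- r) (h y)%:E * (\1_(f @^-1` [set y]) x)%:E)); last first.
  by move=> x _; rewrite (simple_sum h x fr) -sumEFin.
rewrite integral_sum//; last first.
  move=> y; apply: integrableZl => //.
  by apply: integrable_indic; exact: measurable_level.
rewrite /simple_mean -sumEFin; apply: eq_bigr => y _.
have mfy := measurable_level y mf.
rewrite integralZl//; last exact: integrable_indic.
by rewrite integral_indic// setIT EFinM fineK// fin_num_measure.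
Qed.

Lemma simple_mean1 P f r : simple_on f r -> simple_mean P f r (fun=> 1%R) = 1%R.
Proof.
move=> fr; apply: EFin_inj; rewrite -(integral_simple P (fun=> 1%R) fr).
exact: integral_probability_cst.
Qed.

(** * Multiples of indicators as test functions *)

Section weighted_indicator.
Context (t : R) (A : set T) (t0 : (0 < t)%R) (mA : measurable A).

Lemma simple_on_indic : simple_on (fun x => t * \1_A x)%R [:: 0%R; t].
Proof.
split; first by apply: measurable_funM => //; exact: measurable_indic.
- by rewrite /= inE eq_sym gt_eqF.
- move=> x; rewrite indicE; case: (x \in A).
    by rewrite mulr1 !inE eqxx orbT.
  by rewrite mulr0 !inE eqxx.
Qed.

Lemma simple_mean_indic P h :
  simple_mean P (fun x => t * \1_A x)%R [:: 0%R; t] h =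
  (h 0 * (1 - fine (P A)) + h t * fine (P A))%R.
Proof.
have At : (fun x => t * \1_A x)%R @^-1` [set t] = A.
  apply/seteqP; split => x /=; rewrite indicE.
    by case: (boolP (x \in A)) => [/set_mem//|_]; rewrite mulr0 => /eqP; rewrite lt_eqF.
  by move=> Ax; rewrite mem_set// mulr1.
have A0 : (fun x => t * \1_A x)%R @^-1` [set 0%R] = ~` A.
  apply/seteqP; split => x /=; rewrite indicE.
    case: (boolP (x \in A)) => [_|/negP xA _ Ax]; last by apply: xA; rewrite inE.
    by rewrite mulr1 => /eqP; rewrite gt_eqF.
  by move=> Ax; rewrite memNset// mulr0.
rewrite /simple_mean !big_cons big_nil addr0 At A0 (probability_setC _ mA).
by rewrite fineB// fin_num_measure.
Qed.

End weighted_indicator.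

Lemma probability0_of_mul_bounded P A M : measurable A ->
  (forall t, 0 < t -> t * fine (P A) <= M)%R -> P A = 0.
Proof.
move=> mA bnd; rewrite -(fineK (fin_num_measure P A mA)).
have M0 : (0 <= M)%R.
  by apply: le_trans (bnd 1%R ltr01); rewrite mul1r fine_ge0.
congr EFin; apply/eqP; rewrite eq_le fine_ge0// andbT leNgt.
(* This [t] makes [t * P A] equal to [M + 1]. *)
apply/negP => p0; have := bnd ((M + 1) / fine (P A))%R.
rewrite mulfVK ?gt_eqF// divr_gt0 ?ltr_pwDr// => /(_ isT).
by rewrite leNgt ltrDl ltr01.
Qed.

Import HBNNSimple.

Lemma nnsfun_simple_on (f : {nnsfun T >-> R}) :
  exists r, simple_on f r.
Proof.
have fin : finite_set (range f) by [].
exists (finmap.enum_fset (fset_set (range f))); split => //.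
  exact: finmap.fset_uniq.
move=> x; have := in_fset_set fin (f x); rewrite (mem_set (imageT f x)) => fx.
exact: fx.
Qed.

End probabilities.

(** * The variational formula *)

Section variational.
Context d (T : measurableType d) (R : realType).
Implicit Types (P Q : probability T R).
Local Open Scope ereal_scope.

Import HBNNSimple.

(** The integral is a supremum over simple functions below [h]; this turns bounds on finite sums
    into bounds on integrals. *)
Lemma ge0_integral_le_simple P (h : T -> \bar R) (M : \bar R) :
    measurable_fun setT h -> (forall x, 0 <= h x) ->
    (forall f r, simple_on f r -> (forall x, 0 <= f x)%R ->
      (forall x, (f x)%:E <= h x) -> (simple_mean P f r id)%:E <= M) ->
  \int[P]_x h x <= M.
Proof.
move=> mh h0 hM; rewrite ge0_integralTE//; apply: ge_ereal_sup => _ [f fh <-].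
have [r fr] := nnsfun_simple_on f.
rewrite -integralT_nnsfun (integral_simple P id fr).
by apply: hM => // x; exact: fun_ge0.
Qed.

Lemma measurable_lne (g : T -> R) : measurable_fun setT g ->
  measurable_fun setT (fun x => lne (g x)%:E).
Proof.
move=> mg; apply: measurable_fun_ifT; [|exact: measurable_cst|].
  exact: measurable_fun_ler.
by apply/measurable_EFinP; exact: (measurableT_comp (@measurable_ln R)).
Qed.

(** [KL] uses the derivative of charges, the change of variables the sigma-finite one. They agree
    [Q]-almost everywhere, hence [P]-almost everywhere by domination, so one real-valued [g] serves
    both. *)
Lemma KL_density P Q : P `<< Q -> exists g : T -> R,
  [/\ forall x, (0 <= g x)%R, measurable_fun setT g,
      forall h, measurable_fun setT h -> (forall x, 0 <= h x) ->
        \int[P]_x h x = \int[Q]_x (h x * (g x)%:E)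
    & KL P Q = \int[P]_x lne (g x)%:E].
Proof.
move=> PQ; set f := Radon_Nikodym_SigmaFinite.f P Q.
have ffin x : (fine (f x))%:E = f x.
  by rewrite fineK//; exact: Radon_Nikodym_SigmaFinite.f_fin_num.
have f0 x : 0 <= f x by exact: Radon_Nikodym_SigmaFinite.f_ge0.
have mf : measurable_fun setT (fun x => fine (f x)).
  apply/measurable_EFinP; apply: (eq_measurable_fun f).
    by move=> x _; rewrite /= ffin.
  exact: measurable_int (Radon_Nikodym_SigmaFinite.f_integrable PQ).
exists (fun x => fine (f x)); split => //.
- by move=> x; exact: fine_ge0.
- move=> h mh h0; rewrite -(Radon_Nikodym_SigmaFinite.change_of_variables PQ)//.
  by apply: eq_integral => x _; rewrite ffin.
- rewrite /KL asboolT//.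
  set rn := Radon_Nikodym _ _.
  have rnfin x : (fine (rn x))%:E = rn x.
    by rewrite fineK//; exact: Radon_Nikodym_fin_num.
  have mrn : measurable_fun setT (fun x => fine (rn x)).
    apply/measurable_EFinP; apply: (eq_measurable_fun rn).
      by move=> x _; rewrite /= rnfin.
    by apply: (@measurable_int _ _ _ Q); exact: Radon_Nikodym_integrable.
  rewrite (eq_integral (fun x => lne (fine (rn x))%:E)); last first.
    by move=> x _; rewrite rnfin.
  apply: ae_eq_integral => //; [exact: measurable_lne..|].
  have := null_dominates_ae_eq measurableT PQ
    (ae_eq_Radon_Nikodym_SigmaFinite PQ measurableT).
  by apply: filterS => x /(_ I) frn _; rewrite -/f -/rn in frn; rewrite ffin rnfin frn.
Qed.

(* For [theta = 1] this is [D(P||Q) <= M], in a form of the Donsker-Varadhan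
   formula that is linear in [(P, Q)]; a factor [theta > 1] records the loss
   incurred when averaging a kernel over a quasi-invariant prior. *)
Definition dual_bound (theta : R) (P Q : set T -> \bar R) (M : R) :=
  forall f r, simple_on f r ->
    (simple_mean P f r id + 1 - theta * simple_mean Q f r expR <= M)%R.

Lemma dual_le_KL P Q f r : simple_on f r ->
  (simple_mean P f r id + 1 - simple_mean Q f r expR)%:E <= KL P Q.
Proof.
move=> fr; have [mf _ _] := fr.
have [PQ|nPQ] := pselect (P `<< Q); last by rewrite /KL asboolF// leey.
have [g [g0 mg gP ->]] := KL_density PQ.
(* [v = exp f / g] where [g > 0], and [f + 1 - v <= ln g] there. *)
pose v x := expR (f x - ln (g x)).
have mv : measurable_fun setT v.
  apply: measurableT_comp => //; apply: measurable_funB => //.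
  exact: (measurableT_comp (@measurable_ln R)).
have v0 x : (0 <= v x)%R by exact: expR_ge0.
(* The left side is the [Q]-integral of [v * g], which is [exp f] where [g > 0] and [0]
   elsewhere. *)
have vQ : \int[P]_x (v x)%:E <= (simple_mean Q f r expR)%:E.
  rewrite gP//; last exact/measurable_EFinP.
  rewrite -(integral_simple Q expR fr); apply: ge0_le_integral => //.
  - by move=> x _; rewrite -EFinM lee_fin mulr_ge0.
  - by apply/measurable_EFinP; exact: measurable_funM.
  - by apply/measurable_EFinP; exact: measurableT_comp.
  - move=> x _; rewrite -EFinM lee_fin /v.
    have := g0 x; rewrite le_eqVlt => /predU1P[<-|gx0].
      by rewrite mulr0 expR_ge0.
    by rewrite expRD expRN lnK ?posrE// mulfVK// gt_eqF.
have vfin : P.-integrable setT (fun x => (v x)%:E).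
  apply/integrableP; split; first exact/measurable_EFinP.
  under eq_integral do rewrite gee0_abs ?lee_fin//.
  by rewrite (le_lt_trans vQ)// ltry.
(* The [P]-mass of the set where [g <= 0] is the [Q]-integral of [g] over it, and [g] vanishes
   there. *)
have gt0P : {ae P, forall x, (0 < g x)%R}.
  exists [set x | (g x <= 0)%R]; split.
  - rewrite -[X in measurable X]setTI.
    by apply: measurable_fun_le => //; exact: measurable_cst.
  - have mD : measurable [set x | (g x <= 0)%R].
      rewrite -[X in measurable X]setTI.
      by apply: measurable_fun_le => //; exact: measurable_cst.
    rewrite -[LHS]mul1e -integral_cst// integral_mkcond gP; last 2 first.
    + apply/(measurable_restrictT _ _).1 => //; exact: measurable_cst.
    + by move=> x; rewrite erestrict_ge0.
    rewrite integral0_eq// => x _; rewrite patchE; case: ifPn; last by rewrite mul0e.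
    rewrite inE /= => gx; have -> : g x = 0%R by apply/eqP; rewrite eq_le gx g0.
    by rewrite mule0.
  - by move=> x /= /negP; rewrite -leNgt.
apply: (@le_trans _ _ (\int[P]_x ((f x + 1)%:E - (v x)%:E))).
  rewrite integralB//; last exact: (integrable_simple P (fun y => y + 1)%R fr).
  rewrite (integral_simple P (fun y => y + 1)%R fr) EFinB leeB//.
  rewrite lee_fin -[X in (_ + X <= _)%R](simple_mean1 P fr) /simple_mean -big_split/=.
  by apply: ler_sum => y _; rewrite mulrDl.
apply: le_integral_ae.
- apply: emeasurable_funB; apply/measurable_EFinP => //.
  by apply: measurable_funD => //; exact: measurable_cst.
- exact: measurable_lne.
apply: filterS gt0P => x gx; rewrite lne_EFin// -EFinB lee_fin /v.
by have := expR_ge1Dx (f x - ln (g x)); lra.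
Qed.

Lemma KL_ge0 P Q : 0 <= KL P Q.
Proof.
have fr : simple_on (fun _ : T => 0%R : R) [:: 0%R].
  by split => // x; rewrite inE.
have := dual_le_KL P Q fr; rewrite (_ : (_ - _)%R = 0%R)//.
rewrite /simple_mean !big_seq1 mul0r add0r expR0 mul1r.
by rewrite preimage_cst mem_set// probability_setT subrr.
Qed.

(** On a [Q]-null set [A], testing [t * \1_A] gives [t * P A <= M] for every [t > 0]. *)
Lemma dual_bound_dominates P Q M : dual_bound 1 P Q M -> P `<< Q.
Proof.
move=> PQM; apply/null_content_dominatesP => A mA QA0.
apply: (@probability0_of_mul_bounded _ _ _ _ _ M mA) => t t0.
have := PQM _ _ (simple_on_indic t0 mA); rewrite !(simple_mean_indic t0 mA) QA0/=.
by rewrite !mul0r expR0 subr0 mulr0 addr0 !mulr1 add0r addrK.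
Qed.

(** The optimal test function is the log-density. It is truncated at [- N], raised by [N] to be
    nonnegative, and approximated from below by simple functions; then [N] tends to infinity. *)
Lemma KL_le_dual P Q M : dual_bound 1 P Q M -> KL P Q <= M%:E.
Proof.
move=> PQM; have PQ := dual_bound_dominates PQM.
have [g [g0 mg gP ->]] := KL_density PQ.
have intg : \int[Q]_x (g x)%:E = 1.
  rewrite -(probability_setT P) -[RHS]mul1e -integral_cst// gP//.
  by apply: eq_integral => x _; rewrite mul1e.
suff bnd (N : R) : \int[P]_x lne (g x)%:E <= (M + expR (- N))%:E.
  apply/lee_addgt0Pr => e e0.
  by have := bnd (- ln e)%R; rewrite opprK lnK ?posrE.
(* A simple [f <= h] satisfies [exp (f - N) <= g + exp (- N)], so that testing
   against [f - N] costs at most [exp (- N)]. *)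
pose h x := maxe (lne (g x)%:E) (- N)%:E + N%:E.
have mh : measurable_fun setT h.
  apply: emeasurable_funD; last exact: measurable_cst.
  by apply: measurable_maxe; [exact: measurable_lne|exact: measurable_cst].
have h0 x : 0 <= h x.
  by rewrite /h -leeBlDr// sub0e -EFinN le_max lexx orbT.
have hM : \int[P]_x h x <= (M + expR (- N) + N)%:E.
  apply: ge0_integral_le_simple => // f r fr f0 fh.
  have [mf ur rf] := fr.
  have fNr : simple_on (fun x => f x - N)%R [seq y - N | y <- r]%R.
    split.
    - by apply: measurable_funB => //; exact: measurable_cst.
    - by rewrite map_inj_uniq//; exact: addIr.
    - by move=> x; exact: (map_f (fun y => y - N)%R).
  have := PQM _ _ fNr; rewrite mul1r.
  have -> : simple_mean P (fun x => f x - N)%R [seq y - N | y <- r]%R id =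
            (simple_mean P f r id - N)%R.
    apply: EFin_inj; rewrite -(integral_simple P id fNr) EFinB.
    rewrite -(integral_simple P id fr).
    under eq_integral do rewrite EFinB.
    rewrite integralB//; last 2 first.
      exact: (integrable_simple P id fr).
      exact: finite_measure_integrable_cst.
    by rewrite integral_probability_cst.
  have : (simple_mean Q (fun x => f x - N)%R [seq y - N | y <- r]%R expR <=
          1 + expR (- N))%R.
    rewrite -lee_fin -(integral_simple Q expR fNr) EFinD -intg.
    rewrite -[X in _ + X](integral_probability_cst Q) -ge0_integralD//; last 2 first.
    - by move=> x _; rewrite lee_fin.
    - exact/measurable_EFinP.
    apply: ge0_le_integral => //.
    - by apply/measurable_EFinP; apply: measurableT_comp => //; case: fNr.
    - by apply: emeasurable_funD; [exact/measurable_EFinP|exact: measurable_cst].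
    - move=> x _; rewrite /= -EFinD lee_fin.
      have := fh x; rewrite /h -leeBlDr// -EFinB le_max => /orP[|].
        have := g0 x; rewrite le_eqVlt => /predU1P[<-|gx0].
          by rewrite le0_lneNy// leeNy_eq.
        rewrite lne_EFin// lee_fin -ler_expR lnK ?posrE// => /le_trans; apply.
        by rewrite lerDl expR_ge0.
      by rewrite lee_fin -ler_expR => /le_trans; apply; rewrite lerDr.
  rewrite lee_fin; lra.
(* [lne g <= h - N], and the bound on [h] makes it integrable, so [N] can be subtracted back. *)
apply: (@le_trans _ _ (\int[P]_x (h x - N%:E))).
  apply: le_integral_ae; first exact: measurable_lne.
    by apply: emeasurable_funB => //; exact: measurable_cst.
  by apply: aeW => x; rewrite /h addeK// le_max lexx.
have hfin : P.-integrable setT h.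
  apply/integrableP; split => //.
  under eq_integral do rewrite gee0_abs//.
  by rewrite (le_lt_trans hM)// ltry.
rewrite integralB//; last exact: finite_measure_integrable_cst.
by rewrite integral_probability_cst leeBlDr.
Qed.

End variational.

(** * Laplace laws *)

Section laplace.
Context (R : realType).
Notation TR := (measurableTypeR R).
Notation leb := (@lebesgue_measure R).
Local Open Scope ereal_scope.

(** Lebesgue measure is characterised by its values on half-open intervals, whose length a shift
    preserves. *)
Lemma lebesgue_shift (a : R) (A : set TR) : measurable A ->
  leb (shift_fun a @^-1` A) = leb A.
Proof.
move=> mA; rewrite -[LHS]/(pushforward leb (shift_fun a) A).
apply/esym/lebesgue_measure_unique => //= _ [[u v]] _ <-.
rewrite /pushforward.
have -> : shift_fun a @^-1` `]u, v]%classic = `](u - a)%R, (v - a)%R]%classic.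
  by apply/seteqP; split => x /=; rewrite /shift_fun /shift /= !in_itv/= ltrBlDr lerBrDr.
rewrite !lebesgue_measure_itv/= !lte_fin ltrD2r.
by case: ifP => // _; rewrite -!EFinB opprB addrA subrK.
Qed.

Lemma ge0_integral_shift (a : R) (h : TR -> \bar R) :
    measurable_fun setT h -> (forall x, 0 <= h x) ->
  \int[leb]_x h (x + a)%R = \int[leb]_x h x.
Proof.
move=> mh h0.
rewrite -[RHS](@eq_measure_integral _ _ _ _ _ (pushforward leb (shift_fun a))); last first.
  by move=> A mA _; exact: lebesgue_shift.
by rewrite ge0_integral_pushforward//; exact: measurable_shift_fun.
Qed.

(** By symmetry it suffices to treat the half-line, where the integrand is [k^-1] times the
    exponential density of rate [k]. *)
Lemma integral_expR_norm_lty (k : R) : (0 < k)%R ->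
  \int[leb]_x (expR (- (k * `|x|)))%:E < +oo.
Proof.
move=> k0; rewrite ge0_symfun_integralT; last 3 first.
- by move=> x; exact: expR_ge0.
- move=> x; apply: continuous_comp; last exact: continuous_expR.
  by apply: continuousN; apply: continuousM; [exact: cst_continuous|exact: norm_continuous].
- by move=> x; rewrite /= normrN.
have m0 : measurable [set x : R | (0 <= x)%R].
  rewrite (_ : mkset _ = `[0%R, +oo[%classic)//.
  by apply/seteqP; split => x; rewrite /= in_itv/= andbT.
have mf D : measurable_fun D (fun x : R => (expR (- (k * `|x|)))%:E).
  apply/measurable_EFinP/measurableT_comp => //; apply: measurable_funN.
  apply: measurable_funM; first exact: measurable_cst.
  exact: normr_measurable.
rewrite lte_mul_pinfty//.
apply: (@le_lt_trans _ _ (\int[leb]_x (k^-1%:E * (exponential_pdf k x)%:E))).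
  rewrite [leRHS]ge0_integralZl//; last 3 first.
  - by apply/measurable_EFinP; exact: measurable_exponential_pdf.
  - by move=> x _; rewrite lee_fin exponential_pdf_ge0// ltW.
  - by rewrite lee_fin invr_ge0 ltW.
  rewrite -ge0_integralZl//; last 3 first.
  - by apply/measurable_EFinP; exact: measurable_exponential_pdf.
  - by move=> x _; rewrite lee_fin exponential_pdf_ge0// ltW.
  - by rewrite lee_fin invr_ge0 ltW.
  have mg D : measurable_fun D (fun x : R => k^-1%:E * (exponential_pdf k x)%:E).
    apply: measurable_funeM; apply/measurable_EFinP/measurable_funTS.
    exact: measurable_exponential_pdf.
  have g0 (x : R) : 0 <= k^-1%:E * (exponential_pdf k x)%:E.
    by rewrite -EFinM lee_fin mulr_ge0 ?invr_ge0 ?exponential_pdf_ge0// ltW.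
  apply: (@le_trans _ _ (\int[leb]_(x in [set x : R | (0 <= x)%R])
      (k^-1%:E * (exponential_pdf k x)%:E))).
    apply: ge0_le_integral => //.
    - exact: mf.
    - exact: mg.
    - move=> x /= x0; rewrite exponential_pdfE// -EFinM lee_fin mulKf ?gt_eqF//.
      by rewrite ger0_norm// mulNr.
  by apply: ge0_subset_integral => //; exact: mg.
rewrite ge0_integralZl//; last 3 first.
- by apply/measurable_EFinP; exact: measurable_exponential_pdf.
- by move=> x _; rewrite lee_fin exponential_pdf_ge0// ltW.
- by rewrite lee_fin invr_ge0 ltW.
by rewrite integral_exponential_pdf// mule1 ltry.
Qed.

(** A density-free way to say that the log-density is [b]-Lipschitz, as for a Laplace law of rate
    [b]. *)
Definition quasi_invariant (b : R) (P : probability TR R) :=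
  forall (a : R) (A : set TR), measurable A ->
    translate a P A <= (expR (b * `|a|))%:E * P A.

Lemma exists_laplace : exists (W : probability TR R) (k : R), (0 < k)%R /\
  forall h : TR -> \bar R, measurable_fun setT h -> (forall x, 0 <= h x) ->
    \int[W]_x h x = k%:E * \int[leb]_x (h x * (expR (- `|x|))%:E).
Proof.
pose w (x : R) := expR (- `|x|).
have mw : measurable_fun setT w.
  by apply: measurableT_comp => //; apply: measurable_funN; exact: normr_measurable.
have mwE D : measurable_fun D (fun x => (w x)%:E).
  by apply/measurable_EFinP/measurable_funTS.
have w0 x : (0 <= w x)%R by exact: expR_ge0.
set Z := \int[leb]_x (w x)%:E.
have Zoo : Z < +oo.
  have := integral_expR_norm_lty (@ltr01 R); rewrite /Z /w.
  by under eq_integral do rewrite mul1r.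
have Z0 : 0 < Z.
  apply: (@lt_le_trans _ _ (\int[leb]_(x in `[0%R, 1%R]%classic) (expR (- 1))%:E)).
    rewrite integral_cst//= lebesgue_measure_itv/= lte_fin ltr01 sube0 mule1.
    by rewrite lte_fin expR_gt0.
  apply: (@le_trans _ _ (\int[leb]_(x in `[0%R, 1%R]%classic) (w x)%:E)).
    apply: ge0_le_integral => //.
    - exact: mwE.
    - move=> x /=; rewrite in_itv/= => /andP[x0 x1].
      by rewrite lee_fin ler_expR lerN2 ger0_norm.
  apply: ge0_subset_integral => //; first exact: mwE.
  by move=> x _; rewrite lee_fin.
have Zfin : Z \is a fin_num by rewrite ge0_fin_numE// ltW.
set k := (fine Z)^-1%R.
have k0 : (0 < k)%R by rewrite invr_gt0 fine_gt0// Z0.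
pose nu (A : set TR) := \int[leb]_(x in A) (k * w x)%:E.
have mkw D : measurable_fun D (fun x => (k * w x)%:E).
  apply/measurable_EFinP/measurable_funTS; apply: measurable_funM => //.
have kw0 x : 0 <= (k * w x)%:E by rewrite lee_fin mulr_ge0// ltW.
have kwT : \int[leb]_x (k * w x)%:E = 1.
  under eq_integral do rewrite EFinM.
  rewrite ge0_integralZl//; last 3 first.
    exact: mwE.
    by move=> x _; rewrite lee_fin.
    by rewrite lee_fin ltW.
  by rewrite -/Z -(fineK Zfin) -EFinM mulVf// gt_eqF// fine_gt0// Z0.
have [W WE] : exists W : probability TR R, forall A, W A = nu A.
  apply: exists_probability => //.
  - by rewrite /nu integral_set0.
  - by move=> A; apply: integral_ge0.
  - move=> /= F mF tF mUF; rewrite /nu; apply: cvg_toP.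
      apply: ereal_nondecreasing_is_cvgn => m n mn.
      by apply: lee_sum_nneg_natr => // i _ _; apply: integral_ge0.
    by rewrite ge0_integral_bigcup//; exact: mkw.
exists W, k; split => // h mh h0.
have Wleb : W `<< leb.
  apply/null_content_dominatesP => A mA A0; rewrite WE /nu.
  by apply: null_set_integral => //; exact: mkw.
have intkw : leb.-integrable setT (fun x => (k * w x)%:E).
  apply/integrableP; split; first exact: mkw.
  by under eq_integral do rewrite gee0_abs//; rewrite kwT ltry.
(* The Radon-Nikodym derivative of [W] and [k * w] have equal integrals over every measurable
   set. *)
have ae : ae_eq leb setT (Radon_Nikodym_SigmaFinite.f W leb) (fun x => (k * w x)%:E).
  apply: integral_ae_eq => //.
  - exact: Radon_Nikodym_SigmaFinite.f_integrable.
  - exact: mkw.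
  - by move=> A _ mA; rewrite -(Radon_Nikodym_SigmaFinite.f_integral Wleb mA); exact: WE.
rewrite -(Radon_Nikodym_SigmaFinite.change_of_variables Wleb)//.
rewrite -ge0_integralZl//; last 3 first.
- by apply: emeasurable_funM => //; exact: mwE.
- by move=> x _; rewrite mule_ge0// lee_fin expR_ge0.
- by rewrite lee_fin ltW.
apply: ae_eq_integral => //.
- apply: emeasurable_funM => //.
  exact: measurable_int (Radon_Nikodym_SigmaFinite.f_integrable Wleb).
- by apply: measurable_funeM; apply: emeasurable_funM => //; exact: mwE.
- apply: filterS ae => x /(_ I) fx _; rewrite fx EFinM.
  by rewrite muleCA.
Qed.


(** After a Lebesgue shift both sides integrate [\1_A (x + a)], with weights compared by
    [|x + a| <= |x| + |a|]. *)
Lemma quasi_invariant_laplace (W : probability TR R) (k : R) : (0 < k)%R ->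
    (forall h : TR -> \bar R, measurable_fun setT h -> (forall x, 0 <= h x) ->
      \int[W]_x h x = k%:E * \int[leb]_x (h x * (expR (- `|x|))%:E)) ->
  quasi_invariant 1 W.
Proof.
move=> k0 WE a A mA; rewrite mul1r.
have mw : measurable_fun setT (fun x : R => (expR (- `|x|))%:E).
  apply/measurable_EFinP; apply: measurableT_comp => //.
  by apply: measurable_funN; exact: normr_measurable.
have mI (B : set TR) : measurable B -> measurable_fun setT (fun x : TR => (\1_B x)%:E : \bar R).
  by move=> mB; apply/measurable_EFinP; exact: measurable_indic.
have mpA : measurable (shift_fun a @^-1` A).
  by rewrite -[X in measurable X]setTI; exact: measurable_shift_fun.
have WI B : measurable B -> W B = k%:E * \int[leb]_x ((\1_B x)%:E * (expR (- `|x|))%:E).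
  move=> mB; rewrite -WE//; last exact: mI.
  by rewrite integral_indic// setIT.
have -> : translate a W A = W (shift_fun a @^-1` A) by [].
rewrite (WI _ mpA) (WI _ mA) muleCA lee_wpmul2l ?lee_fin ?(ltW k0)//.
rewrite -(@ge0_integral_shift a (fun x => (\1_A x)%:E * (expR (- `|x|))%:E)); last 2 first.
- by apply: emeasurable_funM => //; exact: mI.
- by move=> x; rewrite -EFinM lee_fin mulr_ge0// expR_ge0.
have mwa : measurable_fun setT (fun x : R => (\1_A (x + a)%R)%:E * (expR (- `|x + a|))%:E).
  apply: emeasurable_funM.
    exact: (mI (shift_fun a @^-1` A)).
  exact: (measurableT_comp mw (measurable_shift_fun a)).
rewrite -ge0_integralZl//.
apply: ge0_le_integral => //.
- by apply: emeasurable_funM => //; exact: mI.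
- exact: measurable_funeM.
move=> x _; rewrite -!EFinM lee_fin mulrCA ler_wpM2l// -expRD ler_expR.
have := ler_normD x a; rewrite /=; lra.
Qed.

(** Dividing the variable by [b] turns a shift by [a] into a shift by [a * b]. Small [b] spreads the
    law out, large [b] concentrates it near [0]. *)
Lemma scale_quasi_invariant (W : probability TR R) (b : R) : (0 < b)%R ->
    quasi_invariant 1 W ->
  exists W' : probability TR R, quasi_invariant b W' /\
    forall h : TR -> \bar R, measurable_fun setT h -> (forall x, 0 <= h x) ->
      \int[W']_x h x = \int[W]_x h (x / b)%R.
Proof.
move=> b0 qW; pose X (x : TR) : TR := (x / b)%R.
have mX : measurable_fun setT X.
  by apply: measurable_funM; [exact: measurable_id|exact: measurable_cst].
pose mfX : {mfun TR >-> TR} := HB.pack X (isMeasurableFun.Build _ _ _ _ X mX).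
exists (distribution W mfX); split => [a A mA|h mh h0]; last first.
  by rewrite ge0_integral_distribution.
have -> : translate a (distribution W mfX) A =
          translate (a * b)%R W (X @^-1` A).
  congr (W _); apply/seteqP; split => x /=;
  by rewrite /shift_fun /X /= /shift mulrDl mulfK// gt_eqF.
apply: le_trans (qW _ _ _) _.
  by rewrite -[X in measurable X]setTI; exact: (measurable_funPT mfX).
by rewrite mul1r normrM (gtr0_norm b0) [(b * _)%R]mulrC.
Qed.

Lemma exists_quasi_invariant (b : R) : (0 < b)%R ->
  exists W : probability TR R, quasi_invariant b W.
Proof.
move=> b0; have [W [k [k0 WE]]] := exists_laplace.
have [W' [qW' _]] := scale_quasi_invariant b0 (quasi_invariant_laplace k0 WE).
by exists W'.
Qed.

(** * Growth of the cost and cheap noises *)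

Lemma cost_exp_bound (c : R -> R) : cost_assumptions c ->
  exists2 B, (0 <= B)%R & forall x, (c x <= B * expR (`|x| / 2))%R.
Proof.
move=> hc; have [alpha [beta [alpha0 beta0 tail]]] := cost_tail hc.
have : \forall x \near +oo%R, (c x / (beta * x `^ alpha) < 2)%R.
  by apply: cvgr_lt tail _ _; rewrite ltr1n.
move=> [x0 [_ x0P]].
pose y0 := Num.max 1%R (x0 + 1)%R.
have c0 := cost_ge0 hc.
(* The factor [2 * beta] comes from the tail ratio being below [2]; the rest is [alpha] times
   [ln z <= z - 1] at [z = x / (2 * alpha)]. *)
have big x : (y0 <= x)%R -> (c x <= 2 * beta * (2 * alpha) `^ alpha * expR (x / 2))%R.
  rewrite /y0 ge_max => /andP[x1 xx0].
  have x_gt0 : (0 < x)%R by lra.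
  have /x0P : (x0 < x)%R by lra.
  have pow0 : (0 < x `^ alpha)%R by rewrite powR_gt0.
  rewrite /= ltr_pdivrMr ?mulr_gt0// => /ltW/le_trans; apply.
  rewrite mulrA -[leRHS]mulrA ler_wpM2l ?(mulr_ge0, ltW beta0)//.
  rewrite /powR !gt_eqF ?mulr_gt0// -expRD ler_expR.
  have := @le_ln1Dx R (x / (2 * alpha) - 1)%R.
  rewrite subrKC ln_div ?posrE ?mulr_gt0// => /(_ _)H.
  have {}H : (ln x - ln (2 * alpha) <= x / (2 * alpha) - 1)%R.
    by apply: H; rewrite ltrBrDl subrr divr_gt0// mulr_gt0.
  have -> : (x / 2 = alpha * (x / (2 * alpha)))%R by field; rewrite gt_eqF.
  rewrite -mulrDr ler_wpM2l ?ltW//; lra.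
have e1 (x : R) : (1 <= expR (`|x| / 2))%R.
  by rewrite -expR0 ler_expR divr_ge0.
exists (c y0 + 2 * beta * (2 * alpha) `^ alpha)%R.
  by rewrite addr_ge0// !mulr_ge0// ?powR_ge0// ltW.
move=> x; rewrite mulrDl.
have K0 : (0 <= 2 * beta * (2 * alpha) `^ alpha)%R.
  by rewrite !mulr_ge0// ?powR_ge0// ltW.
have E0 : (0 <= expR (`|x| / 2))%R by exact: expR_ge0.
have [xy|yx] := leP `|x|%R y0.
  apply: (@le_trans _ _ (c y0)).
    by apply: (cost_mono hc); rewrite (le_trans xy)// ler_norm.
  by rewrite (@le_trans _ _ (c y0 * expR (`|x| / 2))%R)// ?ler_peMr// lerDl mulr_ge0.
apply: (@le_trans _ _ (c `|x|%R)).
  by apply: (cost_mono hc); rewrite normr_id.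
by rewrite (le_trans (big _ (ltW yx)))// lerDr mulr_ge0.
Qed.

Lemma measurable_cost (c : R -> R) : cost_assumptions c -> measurable_fun setT c.
Proof. by move=> hc; apply: continuous_measurable_fun; exact: cost_continuous hc. Qed.

(** Dividing a Laplace variable by [n.+1] makes its mean cost tend to [c 0 = 0], by dominated
    convergence with bound [c]; a large rate meets the budget. *)
Lemma exists_cheap_noise (c : R -> R) (C : R) : cost_assumptions c -> (0 < C)%R ->
  exists (b : R) (W : probability TR R),
    [/\ (0 < b)%R, quasi_invariant b W & \int[W]_x (c x)%:E <= C%:E].
Proof.
move=> hc C0; have [W [k [k0 WE]]] := exists_laplace.
have qW := quasi_invariant_laplace k0 WE.
have mc : measurable_fun setT c by exact: measurable_cost.
have c0 x : 0 <= (c x)%:E by rewrite lee_fin; exact: cost_ge0.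
have intc : W.-integrable setT (fun x => (c x)%:E).
  apply/integrableP; split; first exact/measurable_EFinP.
  under eq_integral do rewrite gee0_abs//.
  rewrite WE//; last exact/measurable_EFinP.
  rewrite lte_mul_pinfty ?lee_fin ?(ltW k0)//.
  have [B B0 cB] := cost_exp_bound hc.
  have mE2 : measurable_fun setT (fun x : R => (expR (- (2^-1 * `|x|)))%:E).
    apply/measurable_EFinP/measurableT_comp => //; apply: measurable_funN.
    apply: measurable_funM; first exact: measurable_cst.
    exact: normr_measurable.
  apply: (@le_lt_trans _ _ (B%:E * \int[leb]_x (expR (- (2^-1 * `|x|)))%:E)).
    rewrite -ge0_integralZl//.
    apply: ge0_le_integral => //.
    - by move=> x _; rewrite mule_ge0// lee_fin expR_ge0.
    - apply: emeasurable_funM; first exact/measurable_EFinP.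
      apply/measurable_EFinP/measurableT_comp => //; apply: measurable_funN.
      exact: normr_measurable.
    - exact: measurable_funeM.
    - move=> x _; rewrite -!EFinM lee_fin.
      apply: (@le_trans _ _ (B * expR (`|x| / 2) * expR (- `|x|))%R).
        by rewrite ler_wpM2r// expR_ge0.
      rewrite -mulrA ler_wpM2l// -expRD ler_expR; lra.
  by rewrite lte_mul_pinfty// integral_expR_norm_lty.
have [] := @dominated_convergence _ _ _ W setT measurableT
  (fun n x => (c (x / n.+1%:R)%R)%:E) (cst 0) (fun x => (c x)%:E).
- move=> n; apply/measurable_EFinP; apply: measurableT_comp => //.
  by apply: measurable_funM => //; exact: measurable_cst.
- exact: measurable_cst.
- apply: aeW => x _; apply/cvg_EFin; first exact: nearW.
  have xn : (x / n.+1%:R)%R @[n --> \oo] --> (0 : R)%R.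
    rewrite -[X in _ --> X](mulr0 x); apply: cvgMr.
    exact: cvg_harmonic.
  rewrite (_ : _ \o _ = c \o (fun n => x / n.+1%:R)%R)// -[X in _ --> X](cost0 hc).
  by apply: cvg_comp; [exact: xn|exact: cost_continuous].
- exact: intc.
- apply: aeW => x n _; rewrite gee0_abs// lee_fin; apply: (cost_mono hc).
  by rewrite normrM ler_piMr// ger0_norm// invf_le1// ler1n.
move=> _ _; rewrite integral_cst// mul0e => cvgW.
have [n nC] : exists n, \int[W]_x (c (x / n.+1%:R)%R)%:E <= C%:E.
  apply: contrapT => /forallNP nC.
  have : C%:E <= 0.
    rewrite -(cvg_lim _ cvgW)//; apply: lime_ge; first by apply/cvg_ex; exists 0.
    apply: nearW => n.
    by have := nC n; move/negP; rewrite -ltNge => /ltW.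
  by rewrite lee_fin leNgt C0.
have n0 : (0 < n.+1%:R :> R)%R by rewrite ltr0n.
have [W' [qW' W'E]] := scale_quasi_invariant n0 qW.
exists n.+1%:R, W'; split => //.
rewrite W'E//; exact/measurable_EFinP.
Qed.

End laplace.

(** * Translates of a noise *)

Section noises.
Context (R : realType).
Notation TR := (measurableTypeR R).
Notation leb := (@lebesgue_measure R).
Implicit Types (P W : probability TR R) (c : R -> R).
Local Open Scope ereal_scope.

Lemma measurable_shift_preimage (a : R) (A : set TR) :
  measurable A -> measurable (shift_fun a @^-1` A).
Proof. by rewrite -[X in _ -> measurable X]setTI; exact: measurable_shift_fun. Qed.

Lemma simple_on_shift (a : R) (f : TR -> R) r :
  simple_on f r -> simple_on (f \o shift_fun a) r.
Proof.
case=> mf ur fr; split => //; last by move=> x; exact: fr.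
exact: measurableT_comp mf (measurable_shift_fun a).
Qed.

Lemma simple_mean_translate a P f r h :
  simple_mean (translate a P) f r h = simple_mean P (f \o shift_fun a) r h.
Proof. by []. Qed.

Lemma ler_simple_mean (P Q : probability TR R) (f : TR -> R) r (h : R -> R) (k : R) :
    simple_on f r -> (forall x, 0 <= h (f x))%R ->
    (forall A, measurable A -> P A <= k%:E * Q A) ->
  (simple_mean P f r h <= k * simple_mean Q f r h)%R.
Proof.
move=> [mf _ _] h0 PQ; rewrite /simple_mean mulr_sumr; apply: ler_sum => y _.
(* At a value of [r] that [f] omits [h] may be negative, but the level set is empty. *)
have [[x fx]|yf] := pselect (exists x, f x = y); last first.
  rewrite (_ : f @^-1` [set y] = set0) ?measure0 ?mulr0//.
  by apply/seteqP; split => // x /= fx; apply: yf; exists x.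
rewrite mulrCA ler_wpM2l//; first by rewrite -fx.
have mfy := measurable_level y mf.
by rewrite -lee_fin EFinM !fineK ?fin_num_measure// PQ.
Qed.

Lemma simple_mean_ge0 P (f : TR -> R) r (h : R -> R) :
  (forall y, 0 <= h y)%R -> (0 <= simple_mean P f r h)%R.
Proof. by move=> h0; apply: sumr_ge0 => y _; rewrite mulr_ge0// fine_ge0. Qed.

(** With [m = b * |a|], [P] is at most [exp m] times its translate; then [y + 1 - exp (y - m) <= m]
    is summed over the levels [y] of [f]. *)
Lemma quasi_invariant_dual_bound b P a : quasi_invariant b P ->
  dual_bound 1 P (translate a P) (b * `|a|).
Proof.
move=> qP f r fr; rewrite mul1r.
set m := (b * _)%R.
have PQ A : measurable A -> P A <= (expR m)%:E * translate a P A.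
  move=> mA; have := qP (- a)%R _ (measurable_shift_preimage a mA).
  have E : shift_fun (- a) @^-1` (shift_fun a @^-1` A) = A.
    by apply/seteqP; split => x /=; rewrite /shift_fun /= subrK.
  by rewrite -[translate (- a) P _]/(P (shift_fun (- a) @^-1` (shift_fun a @^-1` A))) E normrN.
have H : (simple_mean P f r expR <= expR m * simple_mean (translate a P) f r expR)%R.
  by apply: ler_simple_mean => // x; exact: expR_ge0.
suff : (simple_mean P f r id + 1 - expR (- m) * simple_mean P f r expR <= m)%R.
  apply: le_trans; rewrite lerD2l lerN2 expRN ler_pdivrMl ?expR_gt0//.
rewrite -[X in (_ + X - _ <= _)%R](simple_mean1 P fr).
rewrite -[leRHS]mulr1 -[X in (_ <= m * X)%R](simple_mean1 P fr).
rewrite /simple_mean !mulr_sumr -big_split/= -sumrB; apply: ler_sum => y _.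
rewrite mulrA -expRD -!mulrDl -mulrBl mulrA ler_wpM2r ?fine_ge0//.
have := expR_ge1Dx (- m + y)%R; lra.
Qed.

Lemma quasi_invariant_integral b W a (h : TR -> \bar R) : quasi_invariant b W ->
    measurable_fun setT h -> (forall x, 0 <= h x) ->
  \int[W]_x h (x + a)%R <= (expR (b * `|a|))%:E * \int[W]_x h x.
Proof.
move=> qW mh h0.
rewrite -[leLHS](@ge0_integral_distribution _ _ _ _ _ W (shift_fun a))//.
apply: ge0_integral_le_simple => // f r fr f0 fh.
apply: (@le_trans _ _ ((expR (b * `|a|) * simple_mean W f r id)%R%:E)).
  rewrite lee_fin; apply: ler_simple_mean => // A mA; exact: qW.
rewrite EFinM lee_wpmul2l ?lee_fin ?expR_ge0// -(integral_simple W id fr).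
apply: ge0_le_integral => //.
- by move=> x _; rewrite lee_fin.
- by apply/measurable_EFinP; case: fr.
Qed.

(** * Lebesgue averages of translates *)

Definition add_set (A : set TR) : set (TR * TR) := [set p | A (p.2 + p.1)%R].

Lemma measurable_add_set A : measurable A -> measurable (add_set A).
Proof.
move=> mA; rewrite -[add_set A]setTI.
have : measurable_fun setT (fun p : TR * TR => (p.2 + p.1)%R : TR).
  by apply: measurable_funD; [exact: measurable_snd|exact: measurable_fst].
by apply.
Qed.

Lemma xsection_add_set A x : xsection (add_set A) x = shift_fun x @^-1` A.
Proof. by apply/seteqP; split => y /=; rewrite /xsection /= inE. Qed.

Lemma ysection_add_set A y : ysection (add_set A) y = shift_fun y @^-1` A.
Proof.
apply/seteqP; split => x /=; rewrite /ysection /= inE /add_set /=.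
  by rewrite /shift_fun /= addrC.
by rewrite /shift_fun /= addrC.
Qed.

Lemma measurable_translate P (A : set TR) : measurable A ->
  measurable_fun setT (fun a : TR => translate a P A).
Proof.
move=> /measurable_add_set/(measurable_fun_xsection P); apply: eq_measurable_fun.
by move=> a _; rewrite /= xsection_add_set.
Qed.

(** Fubini: for each value of the noise, the shifts that carry it into [A] form a translate of
    [A]. *)
Lemma integral_translate P (A : set TR) : measurable A ->
  \int[leb]_a translate a P A = leb A.
Proof.
move=> mA; have mS := measurable_add_set mA.
have := indic_fubini_tonelli leb P mS.
rewrite indic_fubini_tonelli_FE// indic_fubini_tonelli_GE// => H.
transitivity (\int[leb]_x (P \o xsection (add_set A)) x).
  by apply: eq_integral => x _; rewrite /= xsection_add_set.
rewrite H -[RHS](integral_probability_cst P); apply: eq_integral => y _.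
by rewrite /= ysection_add_set lebesgue_shift.
Qed.

(* Test against [t * \1_A] and average over the shifts [a] in [[-s, s]]: by
   Fubini the mean of [P (A - a)] is at most the Lebesgue measure of [A] over
   [2 * s]. *)
Lemma dual_bound_lebesgue P (s theta M t l : R) (A : set TR) :
    (0 < s)%R -> (0 < theta)%R -> (0 < t)%R ->
    (forall a, (`|a| <= s)%R -> dual_bound theta P (translate a P) M) ->
    measurable A -> leb A <= l%:E ->
  (t * fine (P A) <= M + theta - 1 + theta * (expR t - 1) * (l / (2 * s)))%R.
Proof.
move=> s0 theta0 t0 PM mA Al.
have e0 : (0 < expR t - 1)%R by rewrite subr_gt0 -[ltLHS]expR0 ltr_expR.
have te0 : (0 < theta * (expR t - 1))%R by rewrite mulr_gt0.
set p := fine (P A).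
(* [k] is the lower bound on [P (A - a)] that the test function [t * \1_A] gives for every
   [|a| <= s]. *)
pose k := ((t * p + 1 - theta - M) / (theta * (expR t - 1)))%R.
suff kl : (k <= l / (2 * s))%R.
  have := ler_wpM2l (ltW te0) kl; rewrite /k mulrCA divff ?gt_eqF// mulr1; lra.
have l0 : (0 <= l)%R by rewrite -lee_fin (le_trans _ Al).
have [k0|k0] := leP k 0%R; first by rewrite (le_trans k0)// divr_ge0// mulr_ge0// ltW.
have kq a : (`|a| <= s)%R -> k%:E <= translate a P A.
  move=> /PM /(_ _ _ (simple_on_indic t0 mA)); rewrite !(simple_mean_indic t0 mA).
  rewrite -[X in _ -> _ <= X](fineK (fin_num_measure _ _ mA)) lee_fin /k expR0.
  rewrite ler_pdivrMr// -/p; set q := fine _; lra.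
have : \int[leb]_(a in `[(- s)%R, s]%classic) k%:E <= leb A.
  rewrite -(integral_translate P mA).
  apply: (@le_trans _ _ (\int[leb]_(a in `[(- s)%R, s]%classic) translate a P A)).
    apply: ge0_le_integral => //.
    - by move=> x _; rewrite lee_fin ltW.
    - by apply: measurable_funTS; exact: measurable_translate.
    - by move=> a /=; rewrite in_itv/= -ler_norml; exact: kq.
  apply: ge0_subset_integral => //; exact: measurable_translate.
rewrite integral_cst//= lebesgue_measure_itv/= lte_fin ifT; last lra.
move=> /le_trans/(_ Al); rewrite -EFinB -EFinM lee_fin ler_pdivlMr ?mulr_gt0//.
by rewrite opprK -mulr2n mulr_natl.
Qed.

(** On a Lebesgue-null set the averaged inequality reads [t * P A <= M] for every [t > 0]. *)
Lemma dual_bound_dominated P (s M : R) : (0 < s)%R ->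
    (forall a, (`|a| <= s)%R -> dual_bound 1 P (translate a P) M) ->
  P `<< leb.
Proof.
move=> s0 PM; apply/null_content_dominatesP => A mA A0.
apply: (@probability0_of_mul_bounded _ _ _ _ _ M mA) => t t0.
have := @dual_bound_lebesgue P s 1 M t 0 A s0 ltr01 t0 PM mA.
by rewrite A0 mul0r mulr0 addr0 addrK; apply.
Qed.

(** * Noises as additive kernels *)

Definition additive_kernel P : TR -> {measure set TR -> \bar R} :=
  fun x => translate x P.

HB.instance Definition _ P := isKernel.Build _ _ TR TR R (additive_kernel P)
  (fun A mA => @measurable_translate P A mA).

HB.instance Definition _ P := Kernel_isProbability.Build _ _ TR TR R
  (additive_kernel P) (fun x => probability_setT (translate x P)).

(** Translating both laws by [- x] preserves the divergence; in the dual form this only shifts the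
    test function. *)
Lemma kernel_sup_KL_additive s P :
  kernel_sup_KL s (additive_kernel P) <= noise_sup_KL s P.
Proof.
apply: ge_ereal_sup => _ [[x y] /= xy <-].
(* [KL_le_dual] takes a real bound. The value [-oo] is excluded by [KL_ge0] at the shift [0],
   admissible because [0 <= |x - y| <= s]. *)
case Dm : (noise_sup_KL s P) => [m| |]; last 2 first.
- by rewrite leey.
- have : KL P (translate 0 P) <= noise_sup_KL s P.
    apply: ereal_sup_ubound; exists 0%R => //=; rewrite normr0.
    by rewrite (le_trans _ xy).
  by rewrite Dm leeNy_eq => /eqP KLy; have := KL_ge0 P (translate 0 P); rewrite KLy.
apply: KL_le_dual => f r fr; rewrite mul1r.
have : KL P (translate (y - x)%R P) <= m%:E.
  rewrite -Dm; apply: ereal_sup_ubound; exists (y - x)%R => //=.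
  by rewrite distrC.
move=> /(le_trans (dual_le_KL P (translate (y - x)%R P) (simple_on_shift x fr))).
rewrite lee_fin; apply: le_trans.
rewrite simple_mean_translate.
rewrite (_ : (f \o shift_fun x) \o shift_fun (y - x) = f \o shift_fun y)//.
by apply/funext => z; rewrite /= /shift_fun /= -addrA subrK.
Qed.

Lemma integral_additive_kernel P c x : measurable_fun setT c ->
    (forall y, 0 <= c y)%R ->
  \int[kernel_at (additive_kernel P) x]_y (c (y - x)%R)%:E = \int[P]_y (c y)%:E.
Proof.
move=> mc c0.
transitivity (\int[translate x P]_y (c (y - x)%R)%:E); first by [].
rewrite ge0_integral_distribution//.
- by apply: eq_integral => y _; rewrite /= /shift_fun /= addrK.
- apply/measurable_EFinP; apply: measurableT_comp => //.
  by apply: measurable_funB => //; exact: measurable_cst.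
- by move=> y; rewrite lee_fin.
Qed.

Lemma feasible_noisesE C c P : feasible_noises C c P <-> \int[P]_x (c x)%:E <= C%:E.
Proof. by rewrite /feasible_noises /= unlock. Qed.

(** The additive kernel of [P] has the cost of [P] at every input, hence competes in the infimum
    over kernels. *)
Lemma KL_star_le_noise s C c P : cost_assumptions c -> feasible_noises C c P ->
  KL_star s C c <= noise_sup_KL s P.
Proof.
move=> hc /feasible_noisesE PC.
apply: le_trans (kernel_sup_KL_additive s P); apply: ereal_inf_lbound.
exists (additive_kernel P) => //; apply: ge_ereal_sup => _ [x _ <-].
rewrite integral_additive_kernel//; [exact: measurable_cost|exact: cost_ge0].
Qed.

Lemma KL_star_lty s C c : (0 < s)%R -> (0 < C)%R -> cost_assumptions c ->
  KL_star s C c < +oo.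
Proof.
move=> s0 C0 hc; have [b [W [b0 qW WC]]] := exists_cheap_noise hc C0.
have /(KL_star_le_noise s hc)/le_lt_trans : feasible_noises C c W.
  exact/feasible_noisesE.
apply; apply: (@le_lt_trans _ _ (b * s)%:E); last exact: ltry.
apply: ge_ereal_sup => _ [a /= as_ <-].
apply: KL_le_dual => f r fr.
apply: le_trans (quasi_invariant_dual_bound a qW fr) _.
by rewrite ler_wpM2l// ltW.
Qed.

End noises.

(** * Averaging a kernel *)

Section averaging.
Context (R : realType).
Notation TR := (measurableTypeR R).
Implicit Types (P W : probability TR R) (c : R -> R) (K : R.-pker TR ~> TR).
Local Open Scope ereal_scope.

(** The cost constraint tested on simple minorants of [c], each involving finitely many events, so
    that it passes to setwise limits. *)
Definition cost_bound c (C : R) P :=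
  forall f r, simple_on f r -> (forall x, 0 <= f x)%R ->
    (forall x, f x <= c x)%R -> (simple_mean P f r id <= C)%R.

Lemma cost_boundP c C P : measurable_fun setT c -> (forall x, 0 <= c x)%R ->
  cost_bound c C P <-> \int[P]_x (c x)%:E <= C%:E.
Proof.
move=> mc c0; split => [PC|PC f r fr f0 fc].
  apply: ge0_integral_le_simple.
  - exact/measurable_EFinP.
  - by move=> x; rewrite lee_fin.
  - by move=> f r fr f0 fc; rewrite lee_fin PC.
rewrite -lee_fin -(integral_simple P id fr); apply: le_trans PC.
apply: ge0_le_integral => //.
- by move=> x _; rewrite lee_fin.
- by apply/measurable_EFinP; case: fr.
- exact/measurable_EFinP.
- by move=> x _; rewrite lee_fin.
Qed.

(** The law of [Y - x] when [Y] has law [K x]. *)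
Definition recenter K (x : TR) (A : set TR) : \bar R :=
  K x (shift_fun (- x) @^-1` A).

Lemma measurable_recenter K A : measurable A ->
  measurable_fun setT (fun x => recenter K x A).
Proof.
move=> mA; pose S := [set p : TR * TR | A (p.2 - p.1)%R].
have mS : measurable S.
  rewrite -[S]setTI.
  have : measurable_fun setT (fun p : TR * TR => (p.2 - p.1)%R : TR).
    by apply: measurable_funB; [exact: measurable_snd|exact: measurable_fst].
  by apply.
have := measurable_fun_xsection_finite_kernel K (mem_set mS).
apply: eq_measurable_fun => x _; congr (K x _).
by apply/seteqP; split => y /=; rewrite /xsection /= inE.
Qed.

Lemma recenter_le1 K x A : measurable A -> recenter K x A <= 1.
Proof.
by move=> mA; apply: (probability_le1 (kernel_at K x)); exact: measurable_shift_preimage.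
Qed.

Lemma recenter_fin K x A : measurable A -> (fine (recenter K x A))%:E = recenter K x A.
Proof.
move=> mA; rewrite fineK//.
by apply: (fin_num_measure (kernel_at K x)); exact: measurable_shift_preimage.
Qed.

Lemma integrable_recenter K W A : measurable A ->
  W.-integrable setT (fun x => recenter K x A).
Proof.
move=> mA; apply/integrableP; split; first exact: measurable_recenter.
apply: (@le_lt_trans _ _ 1); last exact: ltry.
rewrite -[leRHS](integral_probability_cst W); apply: ge0_le_integral => //.
- by apply: measurableT_comp => //; exact: measurable_recenter.
- by move=> x _; rewrite gee0_abs ?measure_ge0// recenter_le1.
Qed.

(* The law of [Y - X] when [X] has law [W] and [Y] given [X] has law [K X]. *)
Lemma exists_average K W : exists P, forall A,
  P A = \int[W]_x recenter K x A.
Proof.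
apply: exists_probability.
- by rewrite integral0_eq// => x _; rewrite /recenter preimage_set0 measure0.
- by move=> A; apply: integral_ge0 => x _; exact: measure_ge0.
- move=> F mF tF mUF.
  rewrite (_ : \int[W]_x recenter K x (\bigcup_n F n) =
      \sum_(n <oo) \int[W]_x recenter K x (F n)).
    apply: is_cvg_nneseries => n _ _.
    by apply: integral_ge0 => x _; exact: measure_ge0.
  rewrite -integral_nneseries//.
  + apply: eq_integral => x _; rewrite /recenter preimage_bigcup.
    rewrite measure_semi_bigcup//.
    * by move=> i; exact: measurable_shift_preimage.
    * by move=> i j _ _ [y [Fi Fj]]; apply: tF => //; exists (shift_fun (- x) y).
    * by apply: bigcup_measurable => i _; exact: measurable_shift_preimage.
  + by move=> n; exact: measurable_recenter.
- rewrite -[RHS](integral_probability_cst W); apply: eq_integral => x _.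
  by rewrite /recenter preimage_setT prob_kernel.
Qed.

Section average.
Context (K : R.-pker TR ~> TR) (W P : probability TR R)
  (PE : forall A, P A = \int[W]_x recenter K x A).

Let mean f r h x : R := simple_mean (kernel_at K x) (f \o shift_fun (- x)) r h.

Lemma integrable_mean f r h : simple_on f r ->
  W.-integrable setT (fun x => (mean f r h x)%:E).
Proof.
move=> [mf _ _]; apply: (eq_integrable measurableT
  (fun x => \sum_(y <- r) (h y)%:E * recenter K x (f @^-1` [set y]))).
  move=> x _; rewrite /mean /simple_mean -sumEFin; apply: eq_bigr => y _.
  by rewrite EFinM -recenter_fin//; exact: measurable_level.
apply: integrable_sum => // y _; apply: integrableZl => //.
by apply: integrable_recenter; exact: measurable_level.
Qed.

Lemma integral_mean f r h : simple_on f r ->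
  \int[W]_x (mean f r h x)%:E = (simple_mean P f r h)%:E.
Proof.
move=> [mf _ _].
transitivity (\int[W]_x \sum_(y <- r) (h y)%:E * recenter K x (f @^-1` [set y])).
  apply: eq_integral => x _; rewrite /mean /simple_mean -sumEFin; apply: eq_bigr => y _.
  by rewrite EFinM -recenter_fin//; exact: measurable_level.
rewrite integral_sum//; last first.
  move=> y; apply: integrableZl => //.
  by apply: integrable_recenter; exact: measurable_level.
rewrite /simple_mean -sumEFin; apply: eq_bigr => y _.
have mfy := measurable_level y mf.
rewrite integralZl//; last exact: integrable_recenter.
by rewrite -PE// EFinM fineK// fin_num_measure.
Qed.

Lemma average_cost c C : measurable_fun setT c -> (forall x, 0 <= c x)%R ->
  feasible_kernels C c K -> cost_bound c C P.
Proof.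
move=> mc c0 KC f r fr f0 fc.
rewrite -lee_fin -(integral_mean id fr) -(integral_probability_cst W C%:E).
apply: le_integral_ae.
- by apply: measurable_int; exact: (integrable_mean id fr).
- exact: measurable_cst.
apply: aeW => x; rewrite lee_fin.
have KxC : \int[kernel_at K x]_y (c (y - x)%R)%:E <= C%:E.
  by apply: le_trans KC; apply: ereal_sup_ubound; exists x.
move/cost_boundP : KxC; apply => //.
- apply: measurableT_comp => //.
  by apply: measurable_funB => //; exact: measurable_cst.
- exact: simple_on_shift.
- by move=> y; exact: f0.
- by move=> y; exact: fc.
Qed.

(** For each [x], the laws [K x] and [K (x + a)] are tested against the same function [f (y - x)].
    Seen from the centre [x + a] of the second law, this is [f] shifted by [a], whence the translate
    of [P] after averaging. *)
Lemma average_dual_bound (b s M : R) : (0 <= b)%R ->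
    quasi_invariant b W -> kernel_sup_KL s K <= M%:E ->
  forall a, (`|a| <= s)%R -> dual_bound (expR (b * s)) P (translate a P) M.
Proof.
move=> b0 qW KM a as_ f r fr.
have expR_ge0' y : (0 <= expR y :> R)%R by exact: expR_ge0.
have far := simple_on_shift a fr.
pose H x := (mean (f \o shift_fun a) r expR x)%:E.
have mH : measurable_fun setT H.
  by apply: measurable_int; exact: (integrable_mean expR far).
have H0 x : 0 <= H x by rewrite lee_fin; apply: simple_mean_ge0.
have mHa : measurable_fun setT (fun x : TR => H (x + a)%R).
  exact: measurableT_comp mH (measurable_shift_fun a).
(* The second law is averaged at [X + a]; quasi-invariance brings it back to [X] at the price of a
   factor. *)
have intH : \int[W]_x H (x + a)%R <=
    (expR (b * s) * simple_mean (translate a P) f r expR)%:E.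
  apply: (le_trans (quasi_invariant_integral a qW mH H0)).
  rewrite (integral_mean expR far) -EFinM lee_fin simple_mean_translate.
  rewrite ler_wpM2r//; first exact: simple_mean_ge0.
  by rewrite ler_expR ler_wpM2l.
have pt x : (mean f r id x + 1)%:E <= M%:E + H (x + a)%R.
  have KxM : KL (kernel_at K x) (kernel_at K (x + a)%R) <= M%:E.
    apply: le_trans KM; apply: ereal_sup_ubound; exists (x, x + a)%R => //=.
    by rewrite opprD addNKr normrN.
  have := le_trans (dual_le_KL _ _ (simple_on_shift (- x) fr)) KxM.
  rewrite lee_fin lerBlDr => /le_trans; rewrite /H -EFinD lee_fin; apply.
  rewrite lerD2l /mean (_ : _ \o shift_fun (- (x + a)) = f \o shift_fun (- x))//.
  by apply/funext => y; rewrite /= /shift_fun /= opprD addrA subrK.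
have : \int[W]_x (mean f r id x + 1)%:E <= \int[W]_x (M%:E + H (x + a)%R).
  apply: le_integral_ae.
  - apply/measurable_EFinP; apply: measurable_funD; last exact: measurable_cst.
    apply/measurable_EFinP; apply: measurable_int.
    exact: (integrable_mean id fr).
  - by apply: emeasurable_funD => //; exact: measurable_cst.
  - by apply: aeW => x; exact: pt.
under eq_integral do rewrite EFinD.
rewrite integralD//; last 2 first.
  exact: (integrable_mean id fr).
  exact: finite_measure_integrable_cst.
rewrite integralD//; last 2 first.
- exact: finite_measure_integrable_cst.
- apply/integrableP; split => //; under eq_integral do rewrite gee0_abs//.
  by apply: le_lt_trans intH _; exact: ltry.
rewrite !integral_probability_cst (integral_mean id fr).
move=> /le_trans/(_ (leeD2l _ intH)).
by rewrite -EFinD -EFinD lee_fin lerBlDr.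
Qed.

End average.

End averaging.

(** * Setwise limits *)

Section limits.
Context (R : realType).
Notation TR := (measurableTypeR R).
Notation leb := (@lebesgue_measure R).

(** Compactness of [[0, 1]] gives a cluster point; an ultrafilter contains the preimage of each
    neighbourhood or its complement, so a cluster point is a limit. *)
Lemma ultra_cvg_bounded (U : set_system nat) (u : nat -> R) : UltraFilter U ->
  (forall n, 0 <= u n <= 1) -> exists l : R, u n @[n --> U] --> l.
Proof.
move=> UU u01.
have UP : ProperFilter (u n @[n --> U]) by exact: fmap_proper_filter.
have [|l [_ lcl]] := @segment_compact R 0 1 _ UP.
  by apply: nearW => n /=; rewrite in_itv/=.
exists l => V Vl.
have [//|/= nUV] := in_ultra_setVsetC (u @^-1` V) UU.
by have [x []] := lcl (~` V) V nUV Vl.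
Qed.

Section limit_probability.
Context d (T : measurableType d).
Context (U : set_system nat) (P_ : nat -> probability T R) (UU : UltraFilter U).

Let UPF : ProperFilter U. Proof. exact: ultra_proper. Qed.

Context (P_equicontinuous : forall B : nat -> set T,
  (forall k, measurable (B k)) -> (forall k, B k.+1 `<=` B k) ->
  \bigcap_k B k = set0 -> forall e : R, 0 < e ->
  exists k, forall n, fine (P_ n (B k)) <= e).

(** Ultrafilter limits are finitely additive. Continuity at the empty set, being uniform in [n],
    passes to the limit and gives countable additivity. *)
Lemma exists_limit_probability : exists P : probability T R,
  forall A, measurable A -> fine (P_ n A) @[n --> U] --> fine (P A).
Proof.
(* Truncated off the measurable sets, where [P_ n A] is unbounded a priori. *)
pose p A n : R := if `[< measurable A >] then fine (P_ n A) else 0.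
have pE A n : measurable A -> p A n = fine (P_ n A) by move=> mA; rewrite /p asboolT.
have p01 A n : 0 <= p A n <= 1.
  rewrite /p; case: ifPn => [/asboolP mA|_]; last by rewrite lexx ler01.
  by rewrite fine_ge0// fine_probability_le1.
have [L Lp] : {L : set T -> R & forall A, p A n @[n --> U] --> L A}.
  apply: (@choice _ _ (fun A l => p A n @[n --> U] --> l)) => A.
  exact: ultra_cvg_bounded.
have Luniq A l : p A n @[n --> U] --> l -> L A = l.
  by move=> pl; exact: norm_cvg_unique (Lp A) pl.
have L_le A B : (forall n, p A n <= p B n) -> L A <= L B.
  by move=> AB; apply: ler_cvg_to (Lp A) (Lp B) _; exact: nearW.
have L_lec A e : (forall n, p A n <= e) -> L A <= e.
  by move=> AB; apply: ler_cvg_to (Lp A) (cvg_cst e) _; exact: nearW.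
have L_ge0 A : 0 <= L A.
  by apply: ler_cvg_to (cvg_cst 0) (Lp A) _; apply: nearW => n; case/andP: (p01 A n).
have L0 : L set0 = 0.
  apply: Luniq; rewrite (_ : p set0 = fun=> 0); first exact: cvg_cst.
  by apply/funext => n; rewrite pE// measure0.
have LT : L setT = 1.
  apply: Luniq; rewrite (_ : p setT = fun=> 1); first exact: cvg_cst.
  by apply/funext => n; rewrite pE// probability_setT.
have LU A B : measurable A -> measurable B -> A `&` B = set0 ->
    L (A `|` B) = L A + L B.
  move=> mA mB AB; apply: Luniq.
  rewrite (_ : p (A `|` B) = p A \+ p B); first exact: cvgD (Lp A) (Lp B).
  apply/funext => n; rewrite /= !pE//; last exact: measurableU.
  by rewrite measureU// fineD// fin_num_measure.
have Lsum (F : nat -> set T) k : (forall i, measurable (F i)) ->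
    trivIset setT F -> L (\big[setU/set0]_(i < k) F i) = \sum_(0 <= i < k) L (F i).
  move=> mF tF; elim: k => [|k IH]; first by rewrite big_ord0 big_geq.
  rewrite big_ord_recr big_nat_recr//= -IH LU//.
    exact: bigsetU_measurable.
  rewrite big_distrl/= big1// => i _.
  by move/trivIsetP : tF; apply => //; rewrite neq_ltn ltn_ord.
have [P PE] : exists P : probability T R, forall A, P A = (L A)%:E.
  apply: exists_probability.
  - by rewrite L0.
  - by move=> A; rewrite lee_fin.
  - move=> F mF tF mUF.
    (* By disjointness each point lies in a single [F i], so these tails decrease to the empty set;
       [L (B k)] is the remainder of the series. *)
    pose B k := \bigcup_i F (k + i)%N.
    have mB k : measurable (B k) by exact: bigcup_measurable.
    have BS k : B k.+1 `<=` B k.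
      by move=> x [i _ Fx]; exists i.+1 => //; rewrite -addSnnS.
    have B0 : \bigcap_k B k = set0.
      apply/seteqP; split => // x Bx.
      have [i _ Fi] := Bx 0%N I; have [j _ Fj] := Bx (0 + i).+1 I.
      have := tF _ _ I I; move=> /(_ (0 + i)%N ((0 + i).+1 + j)%N) H.
      have : (0 + i = (0 + i).+1 + j)%N by apply: H; exists x.
      by move/eqP; rewrite addSn -addnS -[X in (X == _)]addn0 eqn_add2l.
    have LB k : L (\bigcup_n F n) = \sum_(0 <= i < k) L (F i) + L (B k).
      rewrite (bigcup_splitn k) LU//.
      + by rewrite Lsum.
      + exact: bigsetU_measurable.
      + exact: mB.
      + apply/seteqP; split => // x [].
        rewrite -bigcup_mkord => -[i /= ik Fi] [j _ Fj].
        have := tF _ _ I I; move=> /(_ i (k + j)%N) H.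
        have : (i = k + j)%N by apply: H; exists x.
        by move=> ikj; move: ik; rewrite ikj ltnNge leq_addr.
    rewrite (_ : (fun n => _) = fun n => (\sum_(0 <= i < n) L (F i))%:E); last first.
      by apply/funext => n; rewrite sumEFin.
    apply/cvg_EFin; first exact: nearW.
    rewrite (_ : fine \o _ = fun n => L (\bigcup_n F n) - L (B n)); last first.
      by apply/funext => n; rewrite /= (LB n) addrK.
    rewrite -[X in _ --> X]subr0; apply: cvgB; first exact: cvg_cst.
    apply/cvgrPdist_le => /= e e0.
    have [k0 kB] := P_equicontinuous mB BS B0 e0.
    exists k0 => //= k k0k; rewrite sub0r normrN ger0_norm//.
    apply: le_trans (_ : L (B k0) <= _).
      apply: L_le => n; rewrite !pE// fine_le ?fin_num_measure// le_measure ?inE//.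
      move: k0k => /=; elim: k => [|k IH]; first by rewrite leqn0 => /eqP ->.
      rewrite leq_eqVlt => /predU1P[->//|]; rewrite ltnS => /IH.
      by apply: subset_trans; exact: BS.
    by apply: L_lec => n; rewrite pE.
  - by rewrite LT.
exists P => A mA; rewrite PE/=.
rewrite (_ : (fun n => _) = p A); first exact: Lp.
by apply/funext => n; rewrite pE.
Qed.

End limit_probability.

(** * Compactness of noises of bounded cost and divergence *)

Lemma cost_tail_ge (c : R -> R) (K : R) : cost_assumptions c ->
  exists2 rho, 0 < rho & K <= c rho.
Proof.
move=> hc; have [alpha [beta [alpha0 beta0 tail]]] := cost_tail hc.
have : \forall x \near +oo, 2^-1 < c x / (beta * x `^ alpha).
  by apply: cvgr_gt tail _ _; rewrite invf_lt1// ltr1n.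
move=> [x0 [_ x0P]].
(* Beyond [x0] the cost exceeds half of its power equivalent, so the power itself must reach
   [2 * K / beta]; the maximum with [1] keeps [K'] positive. *)
pose K' := Num.max 1 (2 * K / beta).
have K'0 : 0 < K' by rewrite lt_max ltr01.
pose y := Num.max (Num.max 1 (x0 + 1)) (K' `^ alpha^-1).
have y1 : 1 <= y by rewrite !le_max lexx.
have yx0 : x0 < y.
  by rewrite (@lt_le_trans _ _ (x0 + 1))// ?ltrDl// !le_max lexx orbT.
have y0 : 0 < y by rewrite (lt_le_trans ltr01).
have yK : K' <= y `^ alpha.
  rewrite -[leLHS](@powRr1 _ K') ?(ltW K'0)// -(mulVf (lt0r_neq0 alpha0)) powRrM.
  apply: ge0_ler_powR; rewrite ?nnegrE ?powR_ge0 ?(ltW alpha0) ?(ltW y0)//.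
  by rewrite /y le_max lexx orbT.
exists y => //; have := x0P _ yx0.
rewrite /= ltr_pdivlMr ?mulr_gt0 ?powR_gt0// => /ltW; apply: le_trans.
rewrite ler_pdivlMl// -ler_pdivrMl// mulrC.
by rewrite (le_trans _ yK)// /K' le_max lexx orbT.
Qed.

(** Markov's inequality: [c rho] times the indicator of the complement is a simple function below
    [c]. *)
Lemma cost_bound_tail (c : R -> R) (C rho : R) (P : probability TR R) :
    cost_assumptions c -> cost_bound c C P -> 0 < rho -> 0 < c rho ->
  fine (P (~` `[- rho, rho]%classic)) <= C / c rho.
Proof.
move=> hc PC rho0 crho; pose A : set TR := ~` `[- rho, rho]%classic; rewrite -/A.
have mA : measurable A by apply: measurableC; exact: measurable_itv.
rewrite ler_pdivlMr// mulrC.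
have := PC _ _ (simple_on_indic crho mA).
rewrite (simple_mean_indic crho mA) mul0r add0r.
apply; first by move=> x; rewrite mulr_ge0// ltW.
move=> x; rewrite indicE; case: (boolP (x \in A)) => [|_]; last first.
  by rewrite mulr0 (cost_ge0 hc).
rewrite inE /A /= in_itv/= -ler_norml => /negP; rewrite -ltNge => rx.
by rewrite mulr1; apply: (cost_mono hc); rewrite gtr0_norm// ltW.
Qed.

Section compactness.
Context (s C Theta B m : R) (c : R -> R).
Context (P_ : nat -> probability TR R) (theta M : nat -> R).
Context (s0 : 0 < s) (C0 : 0 < C) (hc : cost_assumptions c)
  (theta_gt0 : forall n, 0 < theta n) (theta_le : forall n, theta n <= Theta)
  (M_le : forall n, M n <= B) (P_cost : forall n, cost_bound c C (P_ n))
  (P_dual : forall n a, `|a| <= s ->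
    dual_bound (theta n) (P_ n) (translate a (P_ n)) (M n)).

(* [t] makes the entropy term small, then [delta] the Lebesgue term, while the
   cost controls the mass outside [[-rho, rho]]. *)
Lemma dual_bound_equicontinuous (D : nat -> set TR) :
    (forall k, measurable (D k)) -> (forall k, D k.+1 `<=` D k) ->
    \bigcap_k D k = set0 -> forall e : R, 0 < e ->
  exists k, forall n, fine (P_ n (D k)) <= e.
Proof.
move=> mD DS D0 e e0.
have [rho rho0 crho] := cost_tail_ge (2 * C / e) hc.
have crho0 : 0 < c rho by rewrite (lt_le_trans _ crho)// divr_gt0// mulr_gt0.
pose I : set TR := `[- rho, rho]%classic.
have mI : measurable I by exact: measurable_itv.
have tail n : fine (P_ n (~` I)) <= e / 2.
  apply: le_trans (cost_bound_tail hc (P_cost n) rho0 crho0) _.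
  rewrite ler_pdivrMr//; move: crho; rewrite ler_pdivrMr//; lra.
have Theta0 : 0 < Theta := lt_le_trans (theta_gt0 0) (theta_le 0).
(* Chosen so that [t * e / 4] equals the bound [|B| + Theta] on the entropy term. *)
pose t := 4 * (`|B| + Theta) / e.
have t0 : 0 < t by rewrite divr_gt0// mulr_gt0// ltr_wpDl.
have et0 : 0 < expR t - 1 by rewrite subr_gt0 -[ltLHS]expR0 ltr_expR.
(* Chosen so that the Lebesgue term is at most [t * e / 4] as well. *)
pose delta := (t * e / 4) * (2 * s) / (Theta * (expR t - 1)).
have delta0 : 0 < delta.
  apply: divr_gt0; apply: mulr_gt0 => //.
  - by apply: divr_gt0 => //; exact: mulr_gt0.
  - exact: mulr_gt0.
(* Intersecting with [I] makes the Lebesgue measure finite, as continuity from above requires. *)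
pose F k := D k `&` I.
have mF k : measurable (F k) by exact: measurableI.
have F0 : \bigcap_k F k = set0.
  by apply/seteqP; split => // x Fx; rewrite -D0 => k _; have [] := Fx k Logic.I.
have cvgF : (leb \o F) k @[k --> \oo] --> (0%E : \bar R).
  have -> : 0%E = leb (\bigcap_k F k) by rewrite F0 measure0.
  apply: nonincreasing_cvg_mu => //.
  - apply: (@le_lt_trans _ _ (leb I)).
      by apply: le_measure; rewrite ?inE//; exact: subIsetr.
    by rewrite lebesgue_measure_itv/=; case: ifP => // _; rewrite -EFinB ltry.
  - by rewrite F0.
  - by apply/nonincreasing_seqP => k; apply/subsetPset; apply: setSI.
have [k Fk] : exists k, (leb (F k) <= delta%:E)%E.
  apply: contrapT => /forallNP nF.
  have : (delta%:E <= 0)%E.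
    apply: (cvge_ge _ cvgF); apply: nearW => k.
    by have := nF k; move/negP; rewrite -ltNge => /ltW.
  by rewrite lee_fin leNgt delta0.
exists k => n.
have PF : fine (P_ n (F k)) <= e / 2.
  rewrite -(ler_pM2l t0).
  apply: le_trans (dual_bound_lebesgue s0 (theta_gt0 n) t0 (P_dual n) (mF k) Fk) _.
  have -> : t * (e / 2) = t * e / 4 + t * e / 4 by field.
  apply: lerD.
    rewrite /t divfK ?gt_eqF// mulrC mulKf//.
    have := M_le n; have := theta_le n; have := ler_norm B; lra.
  apply: (@le_trans _ _ (Theta * (expR t - 1) * (delta / (2 * s)))).
    apply: ler_wpM2r; last by apply: ler_wpM2r; rewrite ?(ltW et0).
    by apply: divr_ge0; [exact: ltW|rewrite mulr_ge0// ltW].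
  rewrite /delta le_eqVlt; apply/orP; left; apply/eqP; field.
  by rewrite !gt_eqF.
have DFC : P_ n (D k) = (P_ n (F k) + P_ n (D k `\` I))%E.
  rewrite setDE -measureU//.
  - by rewrite /F -setIUr setUv setIT.
  - by apply: measurableI => //; exact: measurableC.
  - by rewrite /F setIACA setICr setI0.
have mDI : measurable (D k `\` I) by exact: measurableD.
rewrite DFC fineD ?fin_num_measure//.
have -> : e = e / 2 + e / 2 by field.
apply: lerD => //; apply: le_trans (tail n).
rewrite fine_le ?fin_num_measure//; first exact: measurableC.
by apply: le_measure; rewrite ?inE//; exact: measurableC.
Qed.

Context (theta_cvg : theta n @[n --> \oo] --> (1 : R))
  (M_cvg : M n @[n --> \oo] --> m).

Lemma dual_bound_compactness : exists P : probability TR R, cost_bound c C P /\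
  forall a, `|a| <= s -> dual_bound 1 P (translate a P) m.
Proof.
(* [U] refines the filter at infinity, so the limits of [theta] and [M] persist along it. *)
have [U [UU Uoo]] := ultraFilterLemma eventually_filter.
have UPF : ProperFilter U by exact: ultra_proper.
have [P PE] := exists_limit_probability UU dual_bound_equicontinuous.
have cvgU (u : nat -> R) (l : R) : u n @[n --> \oo] --> l -> u n @[n --> U] --> l.
  by move=> ul V /ul; exact: Uoo.
have mean_cvg f r h : simple_on f r ->
    simple_mean (P_ n) f r h @[n --> U] --> simple_mean P f r h.
  move=> [mf _ _]; rewrite /simple_mean.
  elim: r => [|y r IH].
    rewrite big_nil (_ : (fun n => _) = fun=> 0); first exact: cvg_cst.
    by apply/funext => n; rewrite big_nil.
  rewrite big_cons (_ : (fun n => _) = (fun n => h y * fine (P_ n (f @^-1` [set y]))) \+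
    (fun n => \sum_(z <- r) h z * fine (P_ n (f @^-1` [set z])))); last first.
    by apply/funext => n; rewrite big_cons.
  by apply: cvgD => //; apply: cvgMr; apply: PE; exact: measurable_level.
exists P; split.
  move=> f r fr f0 fc.
  by apply: ler_cvg_to (mean_cvg f r id fr) (cvg_cst C) _; apply: nearW => n; exact: P_cost.
move=> a as_ f r fr; rewrite simple_mean_translate.
have far := simple_on_shift a fr.
have H : simple_mean (P_ n) f r id + 1 -
      theta n * simple_mean (P_ n) (f \o shift_fun a) r expR @[n --> U] -->
    simple_mean P f r id + 1 - 1 * simple_mean P (f \o shift_fun a) r expR.
  apply: cvgB.
    by apply: cvgD; [exact: mean_cvg|exact: cvg_cst].
  by apply: cvgM; [exact: cvgU|exact: mean_cvg].
apply: ler_cvg_to H (cvgU _ _ M_cvg) _.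
by apply: nearW => n; exact: (P_dual n as_ fr).
Qed.

End compactness.

End limits.

(** * Optimal noises *)

Section optimal_noise.
Context (R : realType) (s C : R) (c : R -> R).
Context (s0 : 0 < s) (C0 : 0 < C) (hc : cost_assumptions c).
Notation TR := (measurableTypeR R).

Lemma KL_star_ge0 : (0 <= KL_star s C c)%E.
Proof.
apply: le_ereal_inf_tmp => _ [K KC <-].
apply: le_trans (KL_ge0 (kernel_at K 0) (kernel_at K 0)) _.
by apply: ereal_sup_ubound; exists (0, 0) => //=; rewrite subrr normr0 ltW.
Qed.

Lemma KL_star_fin_num : KL_star s C c \is a fin_num.
Proof. by rewrite ge0_fin_numE ?KL_star_ge0// KL_star_lty. Qed.

(** A kernel within [b] of the infimum is averaged over a prior of constant [b]: one parameter
    governs both losses. *)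
Lemma exists_near_optimal_noise (b : R) : 0 < b ->
  exists P : probability TR R, cost_bound c C P /\
    forall a, `|a| <= s ->
      dual_bound (expR (b * s)) P (translate a P) (fine (KL_star s C c) + b).
Proof.
move=> b0.
have [_ [K KC <-] Kb] := lb_ereal_inf_adherent b0 KL_star_fin_num.
have [W qW] := exists_quasi_invariant b0.
have [P PE] := exists_average K W.
exists P; split.
  by apply: (average_cost PE) KC; [exact: measurable_cost|exact: cost_ge0].
apply: (average_dual_bound PE (ltW b0) qW).
by rewrite EFinD fineK ?KL_star_fin_num// ltW.
Qed.

Lemma exists_optimal_noise : exists P : probability TR R,
  feasible_noises C c P /\ (noise_sup_KL s P <= KL_star s C c)%E.
Proof.
set m := fine (KL_star s C c).
have [P_ P_P] : {P_ : nat -> probability TR R & forall n, cost_bound c C (P_ n) /\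
    forall a, `|a| <= s ->
      dual_bound (expR (n.+1%:R^-1 * s)) (P_ n) (translate a (P_ n)) (m + n.+1%:R^-1)}.
  apply: (@choice _ _ (fun n (P : probability TR R) => cost_bound c C P /\
    forall a, `|a| <= s ->
      dual_bound (expR (n.+1%:R^-1 * s)) P (translate a P) (m + n.+1%:R^-1))) => n.
  by apply: exists_near_optimal_noise; rewrite invr_gt0.
have inv_le1 n : n.+1%:R^-1 <= 1 :> R by rewrite invf_le1// ler1n.
have inv_cvg : n.+1%:R^-1 @[n --> \oo] --> (0 : R) by exact: cvg_harmonic.
have [P [PC PM]] : exists P : probability TR R, cost_bound c C P /\
    forall a, `|a| <= s -> dual_bound 1 P (translate a P) m.
  (* The rates [1 / n.+1] are at most [1], whence the uniform bounds [expR s] and [m + 1]. *)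
  apply: (@dual_bound_compactness R s C (expR s) (m + 1) m c P_
    (fun n => expR (n.+1%:R^-1 * s)) (fun n => m + n.+1%:R^-1) s0 C0 hc).
  - by move=> n; exact: expR_gt0.
  - by move=> n; rewrite ler_expR ler_piMl// ltW.
  - by move=> n; rewrite lerD2l.
  - by move=> n; exact: (P_P n).1.
  - by move=> n; exact: (P_P n).2.
  - rewrite -[X in _ --> X](expR0 R); apply: continuous_cvg; first exact: continuous_expR.
    by rewrite -[X in _ --> X](mul0r s); apply: cvgMl.
  - by rewrite -[X in _ --> X]addr0; apply: cvgD => //; exact: cvg_cst.
exists P; split.
  by apply/feasible_noisesE/cost_boundP => //; [exact: measurable_cost|exact: cost_ge0].
apply: ge_ereal_sup => _ [a /= as_ <-].
by rewrite -(fineK KL_star_fin_num); apply: KL_le_dual; exact: PM.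
Qed.

End optimal_noise.

Theorem theorem1 (R : realType) (s C : R) (c : R -> R)
    (s_gt0 : 0 < s) (C_gt0 : 0 < C) (hc : cost_assumptions c) :
  [/\ KL_star s C c = KL_star_add s C c,
      exists2 P : probability (measurableTypeR R) R,
        feasible_noises C c P & noise_sup_KL s P = KL_star s C c
    & forall P : probability (measurableTypeR R) R,
        feasible_noises C c P -> noise_sup_KL s P = KL_star s C c ->
        P `<< @lebesgue_measure R].
Proof.
have [P [PC PKL]] := exists_optimal_noise s_gt0 C_gt0 hc.
have PE : noise_sup_KL s P = KL_star s C c.
  by apply/eqP; rewrite eq_le PKL KL_star_le_noise.
split.
(* Feasible noises embed as additive kernels; conversely, the optimal [P] is itself a feasible
   noise. *)
- apply/eqP; rewrite eq_le; apply/andP; split.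
    by apply: le_ereal_inf_tmp => _ [Q QC <-]; exact: KL_star_le_noise.
  by rewrite -PE; apply: ereal_inf_lbound; exists P.
- by exists P.
(* The optimal value is finite, so optimality of [Q] gives dual bounds with a real constant at every
   admissible shift. *)
- move=> Q QC QE; apply: (@dual_bound_dominated _ Q s (fine (KL_star s C c))) => //.
  move=> a as_ f r fr; rewrite mul1r -lee_fin fineK ?KL_star_fin_num// -QE.
  apply: le_trans (dual_le_KL _ _ fr) _.
  by apply: ereal_sup_ubound; exists a.
Qed.
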